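(* Let $r\ge 1$ be an integer, let $\mathcal O\subseteq\mathbb R^{n+m}$ be open, and let $f:\mathcal O\to\mathbb R^n$ be of class $C^r$. Let $p$ be a positive integer. Suppose there are $C^1$ maps $$E:\mathfrak B_N^{+}\to\mathbb R^p,\qquad D:\mathcal A\subseteq\mathbb R^p\to\mathbb R^{Nm+(N+1)n},$$ with $E(\mathfrak B_N^{+})\subseteq\mathcal A$, such that $$D\circ E=\operatorname{id}_{\mathfrak B_N^{+}}.$$ Then necessarily $$p\ge n+Nm.$$
   Context: Here $n$ and $m$ are the state and input dimensions, $N$ is a positive integer (the prediction horizon), and $\operatorname{col}(\cdot)$ denotes vertical stacking of vectors. A pair $(x,u)\in\mathbb R^n\times\mathbb R^m$ is identified with a point of $\mathbb R^{n+m}$. The terminal-state-augmented $N$-step behavior of the system $x_{k+1}=f(x_k,u_k)$ is $$\mathfrak B_N^{+}:=\{\operatorname{col}(u_0,\ldots,u_{N-1},x_0,\ldots,x_N)\in\mathbb R^{Nm+(N+1)n} : (x_k,u_k)\in\mathcal O,\ x_{k+1}=f(x_k,u_k),\ k=0,\ldots,N-1\},$$ with $u_k\in\mathbb R^m$ and $x_k\in\mathbb R^n$. It is a $C^r$ embedded submanifold of $\mathbb R^{Nm+(N+1)n}$ of dimension $n+Nm$, and $E$ being $C^1$ is meant with respect to this structure. The condition $D\circ E=\operatorname{id}_{\mathfrak B_N^{+}}$ means $D(E(\mathbf w))=\mathbf w$ for all $\mathbf w\in\mathfrak B_N^{+}$.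
   Formalization: The behavior $\mathfrak B_N^{+}$ is assumed nonempty; if it is empty (for example $\mathcal O=\emptyset$), the empty maps $E$, $D$ with $p=1$ satisfy all the hypotheses and the bound $p\ge n+Nm$ can fail. *)

(* Defs.v *)
From HB Require Import structures.
From mathcomp Require Import all_boot all_order all_algebra.
From mathcomp Require Import all_classical all_reals all_analysis.
Set Implicit Arguments.
Unset Strict Implicit.
Unset Printing Implicit Defensive.
Import Order.TTheory GRing.Theory Num.Theory.
Import numFieldNormedType.Exports.
Local Open Scope classical_set_scope.
Local Open Scope ring_scope.

(* R^a is 'rV[R]_a.  Maps defined on a subset are represented by total maps
   whose values outside of the subset are irrelevant. *)

(* f is of class C^k on U, for U open (the derivatives at a point of U depend
   only on f near that point).  In finite dimension, the Frechet derivative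
   x |-> Df(x) is of class C^k iff x |-> Df(x) v is, for every v. *)
Fixpoint class_C (R : realType) (a b : nat) (k : nat) (U : set 'rV[R]_a)
    (f : 'rV[R]_a -> 'rV[R]_b) : Prop :=
  match k with
  | 0%N => forall x, U x -> {for x, continuous f}
  | k'.+1 => (forall x, U x -> differentiable f x) /\
             (forall v, class_C k' U (fun x => 'D_v f x))
  end.

(* Class C^k on an arbitrary subset A: local extendability to a C^k map on an
   open set.  When A is open this is class_C k A f. *)
Definition class_C_on_subset (R : realType) (a b : nat) (k : nat)
    (A : set 'rV[R]_a) (f : 'rV[R]_a -> 'rV[R]_b) : Prop :=
  forall x, A x -> exists (U : set 'rV[R]_a) (g : 'rV[R]_a -> 'rV[R]_b),
    [/\ open U, U x, class_C k U g & {in U `&` A, f =1 g}].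

(* phi : U -> V is a C^r diffeomorphism between open sets, with inverse psi,
   that flattens U `&` S onto V `&` (R^d x {0}).  The equation d + c = M is
   kept propositional to avoid a cast between 'rV_M and 'rV_(d + c). *)
Definition slice_chart (R : realType) (r M d c : nat) (S : set 'rV[R]_M)
    (U : set 'rV[R]_M) (V : set 'rV[R]_(d + c))
    (phi : 'rV[R]_M -> 'rV[R]_(d + c)) (psi : 'rV[R]_(d + c) -> 'rV[R]_M)
    : Prop :=
  [/\ (d + c)%N = M,
      [/\ open U, open V, class_C r U phi & class_C r V psi],
      [/\ phi @` U = V, psi @` V = U, {in U, cancel phi psi}
        & {in V, cancel psi phi}]
    & phi @` (U `&` S) = V `&` [set row_mx y 0 | y in [set: 'rV[R]_d]]].

(* g is of class C^k on S for the C^r embedded submanifold structure of S: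
   around each point of S there is a slice chart of S in which the coordinate
   representation of g is of class C^k.  The dimension d is that of S near w;
   it is not prescribed. *)
Definition class_C_on_submanifold (R : realType) (r k M p : nat)
    (S : set 'rV[R]_M) (g : 'rV[R]_M -> 'rV[R]_p) : Prop :=
  forall w, S w ->
  exists (d c : nat) (U : set 'rV[R]_M) (V : set 'rV[R]_(d + c))
         (phi : 'rV[R]_M -> 'rV[R]_(d + c)) (psi : 'rV[R]_(d + c) -> 'rV[R]_M),
    [/\ slice_chart r S U V phi psi, U w
      & class_C k [set y : 'rV[R]_d | V (row_mx y 0)]
          (fun y => g (psi (row_mx y 0)))].

(* col(u_0, ..., u_{N-1}, x_0, ..., x_N); mxvec concatenates the rows of a
   matrix in order. *)
Definition stack (R : realType) (n m N : nat)
    (u : 'I_N -> 'rV[R]_m) (x : 'I_N.+1 -> 'rV[R]_n)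
    : 'rV[R]_(N * m + N.+1 * n) :=
  row_mx (mxvec (\matrix_(k < N) u k)) (mxvec (\matrix_(k < N.+1) x k)).

(* For k : 'I_N, widen_ord (leqnSn N) k and lift ord0 k are k and k + 1 in
   'I_N.+1.  The pair (x_k, u_k) is row_mx x_k u_k. *)
Definition behavior_plus (R : realType) (n m N : nat) (O : set 'rV[R]_(n + m))
    (f : 'rV[R]_(n + m) -> 'rV[R]_n) : set 'rV[R]_(N * m + N.+1 * n) :=
  [set w | exists (u : 'I_N -> 'rV[R]_m) (x : 'I_N.+1 -> 'rV[R]_n),
     w = stack u x /\
     forall k : 'I_N,
       O (row_mx (x (widen_ord (leqnSn N) k)) (u k)) /\
       x (lift ord0 k) = f (row_mx (x (widen_ord (leqnSn N) k)) (u k))].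
Arguments behavior_plus {R n m} N O f.
Arguments class_C_on_submanifold {R} r k {M p} S g.

(* Main.v *)
Require Import Defs.
From HB Require Import structures.
From mathcomp Require Import all_boot all_order all_algebra.
From mathcomp Require Import all_classical all_reals all_analysis.
Import Order.TTheory GRing.Theory Num.Theory.
Import numFieldNormedType.Exports.
Local Open Scope classical_set_scope.
Local Open Scope ring_scope.

(** A decoder that is a left inverse of an encoder on a manifold of
    dimension [q] yields, in local coordinates, a factorization of
    the identity of [R^q] through [R^p]; differentiating it at one point, the
    chain rule factors the identity matrix of size [q] through [R^p], so that
    [q <= p] by comparing ranks ([local_retract_dim_le]).

    The manifold is the set of admissible trajectories, and [q = n + N * m]
    because a trajectory is determined by its initial state and its inputs,
    which can be chosen freely in a neighborhood of any admissible choice.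
    Simulating the system from these data ([rollout]) yields a map from
    [R^(n + N * m)] to the behavior that is differentiable wherever it is
    admissible ([rollout_differentiable]), stays in the behavior locally
    ([near_rollout_behavior]) and is inverted by a linear projection
    ([free_data]).  Hence the factorization is [rollout], then the encoder, then
    the decoder, then [free_data].

    Smoothness of the encoder is known only in slice charts of the behavior,
    whose dimension is not given.  Instead of being compared with [q], the chart
    is an intermediate step: near a point, the composite of the encoder with
    [rollout] goes through it as a composite of maps differentiable in the usual
    sense ([submanifold_comp_differentiable]). *)

(** * Differentiability of maps between spaces of row vectors *)

(** A linear map on [R^a] is a finite combination of coordinates, with constant
    coefficients in [W]. *)
Lemma rV_linear_differentiable {R : realType} {W : normedModType R} {a : nat}
    (f : {linear 'rV[R]_a -> W}) (x : 'rV[R]_a) :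
  differentiable f x.
Proof.
have -> : (f : 'rV[R]_a -> W) =
    \sum_(i < a) (fun v : 'rV[R]_a => v 0 i *: f (delta_mx 0 i)).
  rewrite funeqE => v; rewrite fct_sumE {1}[v]row_sum_delta linear_sum.
  by apply: eq_bigr => i _; rewrite linearZ.
apply: differentiable_sum => i.
by apply: differentiableZl; exact: differentiable_coord.
Qed.

Lemma rV_differentiable {R : realType} {V : normedModType R} {b : nat}
    (g : V -> 'rV[R]_b) (x : V) :
  (forall j, differentiable (fun v => g v 0 j) x) -> differentiable g x.
Proof.
move=> dg.
have -> : g = \sum_(j < b) (fun v => g v 0 j *: (delta_mx 0 j : 'rV[R]_b)).
  by rewrite funeqE => v; rewrite fct_sumE {1}[g v]row_sum_delta.
by apply: differentiable_sum => j; exact: differentiableZl.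
Qed.

Lemma differentiable_rV_coord {R : realType} {V : normedModType R} {b : nat}
    (g : V -> 'rV[R]_b) (x : V) (j : 'I_b) :
  differentiable g x -> differentiable (fun v => g v 0 j) x.
Proof.
move=> dg.
by apply: (@differentiable_comp _ _ _ _ g (fun M : 'rV[R]_b => M 0 j));
  [exact: dg | exact: differentiable_coord].
Qed.

Lemma differentiable_row_mx {R : realType} {V : normedModType R} {a b : nat}
    (g : V -> 'rV[R]_a) (h : V -> 'rV[R]_b) (x : V) :
  differentiable g x -> differentiable h x ->
  differentiable (fun v => row_mx (g v) (h v)) x.
Proof.
move=> dg dh; apply: rV_differentiable => j.
case: (split_ordP j) => i ->.
- under eq_fun do rewrite row_mxEl.
  exact: differentiable_rV_coord.
- under eq_fun do rewrite row_mxEr.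
  exact: differentiable_rV_coord.
Qed.

Lemma differentiable_mxvec_rows {R : realType} {V : normedModType R}
    {a b : nat} (g : 'I_a -> V -> 'rV[R]_b) (x : V) :
  (forall k, differentiable (g k) x) ->
  differentiable (fun v => mxvec (\matrix_(k < a) g k v)) x.
Proof.
move=> dg; apply: rV_differentiable => j.
case/mxvec_indexP: j => k i.
under eq_fun do rewrite mxvecE mxE.
exact: differentiable_rV_coord.
Qed.

(** The differentials of [F] at [x] and of [H] at [F x] compose to the identity,
    so that an identity matrix of size [q] is a product of matrices with inner
    dimension [p]. *)
Lemma local_retract_dim_le {R : realType} {q p : nat}
    (F : 'rV[R]_q -> 'rV[R]_p) (H : 'rV[R]_p -> 'rV[R]_q) (x : 'rV[R]_q) :
  differentiable F x -> differentiable H (F x) ->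
  (\forall z \near x, H (F z) = z) -> (q <= p)%N.
Proof.
move=> dF dH HF.
have id_fact : (1%:M : 'M[R]_q) = jacobian F x *m jacobian H (F x).
  apply/row_matrixP => i; rewrite !rowE; set v := delta_mx 0 i.
  have <- : 'D_v (H \o F) x = v *m (jacobian F x *m jacobian H (F x)).
    rewrite deriveE; last exact: differentiable_comp.
    by rewrite diff_comp //= mulmxA /jacobian !mul_rV_lin1.
  rewrite mulmx1 (@near_eq_derive _ _ _ (H \o F) (@idfun 'rV[R]_q)) //.
  by rewrite derive_id.
rewrite -(mxrank1 R q) id_fact.
exact: leq_trans (mxrankM_maxl _ _) (rank_leq_col _).
Qed.

(** * Smooth maps on embedded submanifolds *)

(** In a slice chart [phi] at [G z], the composite is the coordinate
    representation of [g] applied to the first block of [phi \o G]; the second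
    block vanishes because [G] stays in [S].  This holds only near [z],
    whence the auxiliary map [F]. *)
Lemma submanifold_comp_differentiable {R : realType} {r q M p : nat}
    (S : set 'rV[R]_M) (g : 'rV[R]_M -> 'rV[R]_p) (G : 'rV[R]_q -> 'rV[R]_M)
    (z : 'rV[R]_q) :
  (1 <= r)%N -> class_C_on_submanifold r 1 S g ->
  differentiable G z -> (\forall t \near z, S (G t)) ->
  exists2 F : 'rV[R]_q -> 'rV[R]_p,
    differentiable F z & \forall t \near z, F t = g (G t).
Proof.
case: r => // r _ gS dG SG.
have [d [c [U [V [phi [psi [[_ [oU _ [dphi _] _] [_ _ phiK _] flat] UGz
  [dg _]]]]]]]] := gS _ (nbhs_singleton SG).
pose ghat (y : 'rV[R]_d) := g (psi (row_mx y 0)).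
have in_chart t : U (G t) -> S (G t) ->
    V (row_mx (lsubmx (phi (G t))) 0) /\ ghat (lsubmx (phi (G t))) = g (G t).
  move=> Ut St.
  have [Vt [y _ yE]] : (V `&` [set row_mx y 0 | y in [set: 'rV[R]_d]])
      (phi (G t)) by rewrite -flat; exists (G t).
  rewrite /ghat -yE row_mxKl yE; split=> //.
  by rewrite phiK // inE.
exists (fun t => ghat (lsubmx (phi (G t)))).
- apply: (@differentiable_comp _ _ _ _ (fun t => lsubmx (phi (G t))) ghat).
    apply: (@differentiable_comp _ _ _ _ (phi \o G) lsubmx).
      by apply: differentiable_comp => //; exact: dphi.
    exact: differentiable_lsubmx.
  by apply: dg; apply: (in_chart z UGz (nbhs_singleton SG)).1.
- have UG : \forall t \near z, U (G t).
    exact: (differentiable_continuous dG) (open_nbhs_nbhs (conj oU UGz)).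
  by near=> t; apply: (in_chart t _ _).2; near: t.
Unshelve. all: by end_near. Qed.

(** * Trajectories parametrized by initial state and inputs *)

Fixpoint state_at {R : realType} {n m : nat} (f : 'rV[R]_(n + m) -> 'rV[R]_n)
    (x0 : 'rV[R]_n) (u : nat -> 'rV[R]_m) (k : nat) : 'rV[R]_n :=
  if k is j.+1 then f (row_mx (state_at f x0 u j) (u j)) else x0.

(** A vector of [R^(n + N * m)] is read as col(x_0, u_0, ..., u_{N-1}).  Inputs
    are indexed by natural numbers, so that the recursion above needs no
    bound. *)
Definition input_at {R : realType} {n m N : nat} (z : 'rV[R]_(n + N * m))
    (k : nat) : 'rV[R]_m :=
  if insub k is Some i then row (i : 'I_N) (vec_mx (rsubmx z)) else 0.

Definition rollout {R : realType} {n m N : nat}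
    (f : 'rV[R]_(n + m) -> 'rV[R]_n) (z : 'rV[R]_(n + N * m)) :
    'rV[R]_(N * m + N.+1 * n) :=
  stack (fun k : 'I_N => input_at z k)
    (fun k : 'I_N.+1 => state_at f (lsubmx z) (input_at z) k).

Definition free_data {R : realType} {n m N : nat}
    (w : 'rV[R]_(N * m + N.+1 * n)) : 'rV[R]_(n + N * m) :=
  row_mx (row ord0 (vec_mx (rsubmx w))) (lsubmx w).

Lemma input_at_ord {R : realType} {n m N : nat} (z : 'rV[R]_(n + N * m))
    (k : 'I_N) : input_at z k = row k (vec_mx (rsubmx z)).
Proof. by rewrite /input_at valK. Qed.

Lemma free_data_stack {R : realType} {n m N : nat} (u : 'I_N -> 'rV[R]_m)
    (x : 'I_N.+1 -> 'rV[R]_n) :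
  free_data (stack u x) = row_mx (x ord0) (mxvec (\matrix_(k < N) u k)).
Proof. by rewrite /free_data /stack row_mxKl row_mxKr mxvecK rowK. Qed.

Lemma rolloutK {R : realType} {n m N : nat} (f : 'rV[R]_(n + m) -> 'rV[R]_n) :
  cancel (rollout f) (@free_data R n m N).
Proof.
move=> z; rewrite /rollout free_data_stack /= -[RHS]hsubmxK; congr row_mx.
rewrite -[RHS]vec_mxK; congr mxvec.
by apply/row_matrixP => k; rewrite rowK input_at_ord.
Qed.

Lemma free_data_differentiable {R : realType} {n m N : nat}
    (w : 'rV[R]_(N * m + N.+1 * n)) :
  differentiable (@free_data R n m N) w.
Proof.
apply: differentiable_row_mx.
- exact: (rV_linear_differentiable
    (row ord0 \o (vec_mx \o rsubmx) : {linear 'rV[R]_(N * m + N.+1 * n) -> _})).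
- exact: differentiable_lsubmx.
Qed.

Lemma input_at_differentiable {R : realType} {n m N : nat} (k : nat)
    (z : 'rV[R]_(n + N * m)) :
  differentiable (fun t : 'rV[R]_(n + N * m) => input_at t k) z.
Proof.
rewrite /input_at; case: insubP => [i _ _|_]; last exact: differentiable_cst.
exact: (rV_linear_differentiable
  (row i \o (vec_mx \o rsubmx) : {linear 'rV[R]_(n + N * m) -> _})).
Qed.

(** * Local behavior of the simulated trajectories *)

Definition admissible {R : realType} {n m N : nat} (O : set 'rV[R]_(n + m))
    (f : 'rV[R]_(n + m) -> 'rV[R]_n) (z : 'rV[R]_(n + N * m)) : Prop :=
  forall k, (k < N)%N ->
    O (row_mx (state_at f (lsubmx z) (input_at z) k) (input_at z k)).

Lemma admissible_behavior {R : realType} {n m N : nat}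
    (O : set 'rV[R]_(n + m)) (f : 'rV[R]_(n + m) -> 'rV[R]_n)
    (z : 'rV[R]_(n + N * m)) :
  admissible O f z -> behavior_plus N O f (rollout f z).
Proof.
move=> adm; exists (fun k : 'I_N => input_at z k).
exists (fun k : 'I_N.+1 => state_at f (lsubmx z) (input_at z) k).
by split=> // k; split; first exact: adm k (ltn_ord k).
Qed.

(** By induction on time, any trajectory is the one simulated from its own
    initial state and inputs. *)
Lemma behavior_admissible {R : realType} {n m N : nat}
    (O : set 'rV[R]_(n + m)) (f : 'rV[R]_(n + m) -> 'rV[R]_n)
    (w : 'rV[R]_(N * m + N.+1 * n)) :
  behavior_plus N O f w -> admissible O f (free_data w).
Proof.
move=> [u [x [-> xu]]].
set z := free_data _.
have uE (k : 'I_N) : input_at z k = u k.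
  by rewrite input_at_ord /z free_data_stack row_mxKr mxvecK rowK.
have xE k (kN : (k < N.+1)%N) :
    state_at f (lsubmx z) (input_at z) k = x (Ordinal kN).
  elim: k kN => [|k IH] kN /=.
    by rewrite /z free_data_stack row_mxKl; congr x; exact: val_inj.
  have := (xu (Ordinal (kN : k < N)%N)).2.
  rewrite -uE (_ : widen_ord _ _ = Ordinal (ltnW kN)); last exact: val_inj.
  rewrite -IH /= => <-; congr x; exact: val_inj.
move=> k kN; have := (xu (Ordinal kN)).1.
rewrite -uE (_ : widen_ord _ _ = Ordinal (ltnW kN : k < N.+1)%N).
  by rewrite -xE.
exact: val_inj.
Qed.

Lemma state_at_differentiable {R : realType} {n m N : nat}
    (O : set 'rV[R]_(n + m)) (f : 'rV[R]_(n + m) -> 'rV[R]_n)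
    (z : 'rV[R]_(n + N * m)) (k : nat) :
  (forall x, O x -> differentiable f x) -> admissible O f z -> (k <= N)%N ->
  differentiable (fun t : 'rV[R]_(n + N * m) =>
    state_at f (lsubmx t) (input_at t) k) z.
Proof.
move=> df adm; elim: k => [|k IH] kN /=; first exact: differentiable_lsubmx.
apply: (@differentiable_comp _ _ _ _
  (fun t : 'rV[R]_(n + N * m) => row_mx _ _) f); last exact/df/adm.
by apply: differentiable_row_mx;
  [exact: IH (ltnW kN) | exact: input_at_differentiable].
Qed.

Lemma rollout_differentiable {R : realType} {n m N : nat}
    (O : set 'rV[R]_(n + m)) (f : 'rV[R]_(n + m) -> 'rV[R]_n)
    (z : 'rV[R]_(n + N * m)) :
  (forall x, O x -> differentiable f x) -> admissible O f z ->
  differentiable (rollout f) z.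
Proof.
move=> df adm; apply: differentiable_row_mx; apply: differentiable_mxvec_rows.
- by move=> k; exact: input_at_differentiable.
- by move=> k; apply: (state_at_differentiable _ _ _ _ df adm); rewrite -ltnS.
Qed.

(** Admissibility consists of finitely many conditions, each of them open
    where the states depend continuously on the data. *)
Lemma near_rollout_behavior {R : realType} {n m N : nat}
    (O : set 'rV[R]_(n + m)) (f : 'rV[R]_(n + m) -> 'rV[R]_n)
    (z : 'rV[R]_(n + N * m)) :
  open O -> (forall x, O x -> differentiable f x) -> admissible O f z ->
  \forall t \near z, behavior_plus N O f (rollout f t).
Proof.
move=> oO df adm.
have adm_near : \forall t \near z, forall k : 'I_N,
    O (row_mx (state_at f (lsubmx t) (input_at t) k) (input_at t k)).
  apply: (@filter_forall _ _ _ (nbhs z)) => k.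
  have dxu : differentiable (fun t : 'rV[R]_(n + N * m) =>
      row_mx (state_at f (lsubmx t) (input_at t) k) (input_at t k)) z.
    apply: differentiable_row_mx; last exact: input_at_differentiable.
    exact: (state_at_differentiable _ _ _ _ df adm (ltnW (ltn_ord k))).
  have Oz : O (row_mx (state_at f (lsubmx z) (input_at z) k) (input_at z k)).
    exact: adm k (ltn_ord k).
  exact: (differentiable_continuous dxu) (open_nbhs_nbhs (conj oO Oz)).
apply: filterS adm_near => t admt; apply: admissible_behavior => k kN.
exact: (admt (Ordinal kN)).
Qed.

Theorem corollary4p4 (R : realType) (n m N r p : nat)
    (hN : (0 < N)%N) (hr : (1 <= r)%N) (hp : (0 < p)%N)
    (O : set 'rV[R]_(n + m)) (hO : open O)
    (f : 'rV[R]_(n + m) -> 'rV[R]_n) (hf : class_C r O f)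
    (hB : behavior_plus N O f !=set0)
    (E : 'rV[R]_(N * m + N.+1 * n) -> 'rV[R]_p)
    (hE : class_C_on_submanifold r 1 (behavior_plus N O f) E)
    (A : set 'rV[R]_p)
    (D : 'rV[R]_p -> 'rV[R]_(N * m + N.+1 * n))
    (hD : class_C_on_subset 1 A D)
    (hEA : E @` behavior_plus N O f `<=` A)
    (hDE : forall w, behavior_plus N O f w -> D (E w) = w) :
  (n + N * m <= p)%N.
Proof.
have df x : O x -> differentiable f x.
  by case: r hr hf {hE} => // r _ [df _]; exact: df.
case: hB => w Bw; pose z := free_data w.
have adm : admissible O f z := behavior_admissible _ _ _ Bw.
have dG := rollout_differentiable _ _ _ df adm.
have BG := near_rollout_behavior _ _ _ hO df adm.
have [F dF FE] := submanifold_comp_differentiable _ _ _ _ hr hE dG BG.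
have AF : A (F z).
  by rewrite (nbhs_singleton FE); apply: hEA; exists (rollout f z) => //;
    exact: nbhs_singleton BG.
have [U [g [oU UF [dg _] gD]]] := hD _ AF.
have UFnear : \forall t \near z, U (F t).
  exact: (differentiable_continuous dF) (open_nbhs_nbhs (conj oU UF)).
apply: (local_retract_dim_le F (free_data \o g) z dF).
  apply: differentiable_comp; first exact: dg.
  exact: free_data_differentiable.
(* Near [z], [F t] encodes a trajectory and lies where [g] extends [D], so that
   [g] returns this trajectory and [free_data] recovers [t]. *)
near=> t.
have Bt : behavior_plus N O f (rollout f t) by near: t.
have Ft : F t = E (rollout f t) by near: t.
rewrite /= -gD; first by rewrite Ft hDE // rolloutK.
rewrite inE; split; first by near: t.
by rewrite Ft; apply: hEA; exists (rollout f t).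
Unshelve. all: by end_near. Qed.
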